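(* Let $R$ be a finite chain ring of length $2$ with residue field $\mathbb{F}_q$, and let $n$ be an integer with $q^2-q\le n\le q^2-2$. Then there exists a projective $(q^2n-2q,\,n)$-arc in $\mathrm{PHG}(2,R)$. Consequently, writing $n=q^2-q+t$ with $t\in\{0,1,\dots,q-2\}$, $$\mathrm{m}_n(R)\ge q(q+1)n-q^3+q(q-2-t).$$
   Context: Throughout, $R$ is a finite chain ring of nilpotency index (length) $2$, i.e. a finite local ring with radical $\mathrm{rad}R\neq 0$, $(\mathrm{rad}R)^2=0$, whose one-sided ideals form the chain $R\supsetneq\mathrm{rad}R\supsetneq 0$, with residue field $R/\mathrm{rad}R\cong\mathbb{F}_q$ ($q$ a prime power); then $|R|=q^2$. The projective Hjelmslev plane $\mathrm{PHG}(2,R)$ is the incidence structure whose points are the free rank-$1$ submodules of the right module $R_R^3$, whose lines are the free rank-$2$ submodules of $R_R^3$, with incidence given by inclusion; it has $q^4+q^3+q^2$ points and each line contains $q^2+q$ points. A $(k,n)$-arc is a map $\mathcal{K}$ from the point set to $\mathbb{N}_0$ with $\sum_x\mathcal{K}(x)=k$ and $\sum_{x\in L}\mathcal{K}(x)\le n$ for every line $L$; it is projective if $\mathcal{K}$ takes only values in $\{0,1\}$ (i.e. it is a set of $k$ points meeting every line in at most $n$ points). For $0\le n\le q^2+q$, $\mathrm{m}_n(R)$ denotes the largest $k$ such that a projective $(k,n)$-arc exists in $\mathrm{PHG}(2,R)$. *)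

(* Defs.v *)
From mathcomp Require Import all_boot all_order all_algebra.
Set Implicit Arguments. Unset Strict Implicit. Unset Printing Implicit Defensive.
Import GRing.Theory.
Local Open Scope ring_scope.

Section PHG.
Variable R : finNzRingType.

Definition is_right_ideal (I : {set R}) : Prop :=
  [/\ 0 \in I, (forall x y, x \in I -> y \in I -> x - y \in I)
    & (forall x r, x \in I -> x * r \in I)].
Definition is_left_ideal (I : {set R}) : Prop :=
  [/\ 0 \in I, (forall x y, x \in I -> y \in I -> x - y \in I)
    & (forall x r, x \in I -> r * x \in I)].

(* R is a finite chain ring of length 2 with radical N: the one-sided ideals of
   R are exactly R, N, 0 (a chain R > N > 0), N <> 0, N <> R, and N^2 = 0. *)
Definition chain_ring2 (N : {set R}) : Prop :=
  [/\ (forall I, is_right_ideal I <-> (I = setT \/ I = N \/ I = [set 0])),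
      (forall I, is_left_ideal I <-> (I = setT \/ I = N \/ I = [set 0])),
      N != [set 0], N != setT
    & (forall x y, x \in N -> y \in N -> x * y = 0)].

Definition vec := {ffun 'I_3 -> R}.
Definition vadd (x y : vec) : vec := [ffun i => x i + y i].
Definition vscale (x : vec) (r : R) : vec := [ffun i => x i * r].
Definition vzero : vec := [ffun => 0].

Definition is_point (P : {set vec}) : bool :=
  [exists x : vec, (P == [set vscale x r | r : R]) &&
    [forall r : R, (vscale x r == vzero) ==> (r == 0)]].

Definition is_line (L : {set vec}) : bool :=
  [exists x : vec, exists y : vec,
    (L == [set vadd (vscale x a) (vscale y b) | a : R, b : R]) &&
    [forall a : R, forall b : R,
       (vadd (vscale x a) (vscale y b) == vzero) ==> (a == 0) && (b == 0)]].

Definition proj_arc (S : {set {set vec}}) (k n : nat) : bool :=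
  [&& [forall P in S, is_point P], #|S| == k
    & [forall L : {set vec}, is_line L ==> (#|[set P in S | P \subset L]| <= n)%N]].

Definition max_proj_arc (n : nat) : nat :=
  \max_(S : {set {set vec}} | proj_arc S #|S| n) #|S|.

End PHG.

(* Main.v *)
Require Import Defs.
From mathcomp Require Import all_boot all_order all_algebra.
From mathcomp Require Import zify.
Set Implicit Arguments. Unset Strict Implicit. Unset Printing Implicit Defensive.
Import GRing.Theory.
Local Open Scope ring_scope.

(** Write q = |N| and n = q^2 - s with 2 <= s <= q.  It suffices to find a set
    of at most q^3 + (s+1) q^2 + 2q points meeting every line in at least q + s
    points; its complement contains the arc.

    Fix a neighbour class x0 and a neighbour class of lines d through x0.  Inside
    each neighbour class of points, an affine plane of order q, the blocking set
    consists of parallel segments of q points.  In x0 there are s segments, in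
    the direction of d.  On d and on s - 2 further line classes through x0, every
    point class gets two segments pointing to x0; on the other q + 2 - s line
    classes m through x0, every point class gets one segment, pointing to a class
    z_m on d, and each z_m receives a third segment pointing to x0.  A line not
    through x0 then meets at least q + s points: the hit that it may lose in m
    because it passes through z_m is given back by the third segment there.  For
    lines through x0, the segments pointing to x0 are placed so that each line
    contains enough of them.  Three segments in one class require q >= 3; for
    q = 2 a quadrangle is an arc of the required size.

    A residue class z mod N is encoded by th * z, for a fixed nonzero th in N;
    thus N itself serves as the residue field, and neither a quotient ring nor
    commutativity is needed. *)

(** * Arithmetic of a chain ring of length 2 *)

Section ChainRing.
Variables (R : finNzRingType) (N : {set R}).
Hypothesis chainN : chain_ring2 N.

Lemma rad_sub x y : x \in N -> y \in N -> x - y \in N.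
Proof.
by case: chainN => hr _ _ _ _; have [_ h _] := (hr N).2 (or_intror (or_introl erefl)); apply: h.
Qed.

Lemma rad_mulr x r : x \in N -> x * r \in N.
Proof.
by case: chainN => hr _ _ _ _; have [_ _ h] := (hr N).2 (or_intror (or_introl erefl)); apply: h.
Qed.

Lemma rad_mull x r : x \in N -> r * x \in N.
Proof.
by case: chainN => _ hl _ _ _; have [_ _ h] := (hl N).2 (or_intror (or_introl erefl)); apply: h.
Qed.

Lemma rad0 : 0 \in N.
Proof.
by case: chainN => hr _ _ _ _; have [] := (hr N).2 (or_intror (or_introl erefl)).
Qed.

Lemma rad_opp x : x \in N -> - x \in N.
Proof. by move=> xN; rewrite -sub0r rad_sub ?rad0. Qed.

Lemma rad_add x y : x \in N -> y \in N -> x + y \in N.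
Proof. by move=> xN yN; rewrite -[y]opprK rad_sub ?rad_opp. Qed.

Lemma rad_mul0 x y : x \in N -> y \in N -> x * y = 0.
Proof. by case: chainN => _ _ _ _; apply. Qed.

Lemma rad1F : 1 \notin N.
Proof.
apply/negP => h; case: chainN => _ _ _ /eqP NT _; apply: NT; apply/setP => x.
by rewrite inE -[x]mul1r rad_mulr.
Qed.

Lemma principal_right x : is_right_ideal [set x * r | r : R].
Proof.
split; first by apply/imsetP; exists 0; rewrite ?inE ?mulr0.
  move=> _ _ /imsetP[r _ ->] /imsetP[t _ ->]; apply/imsetP; exists (r - t) => //.
  by rewrite mulrBr.
by move=> _ t /imsetP[r _ ->]; apply/imsetP; exists (r * t); rewrite ?mulrA.
Qed.

Lemma principal_left x : is_left_ideal [set r * x | r : R].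
Proof.
split; first by apply/imsetP; exists 0; rewrite ?inE ?mul0r.
  move=> _ _ /imsetP[r _ ->] /imsetP[t _ ->]; apply/imsetP; exists (r - t) => //.
  by rewrite mulrBl.
by move=> _ t /imsetP[r _ ->]; apply/imsetP; exists (t * r); rewrite ?mulrA.
Qed.

(** Both principal ideals of [x] contain [x], so neither is [N] or 0; each is the whole ring and
    contains 1. The two one-sided inverses then agree. *)
Lemma unit_inv x : x \notin N -> exists2 y, x * y = 1 & y * x = 1.
Proof.
move=> xN; case: chainN => hr hl _ _ _.
have x0 : x \notin [set 0] by apply: contra xN => /set1P->; apply: rad0.
have [y hy] : exists y, x * y = 1.
  have xin : x \in [set x * r | r : R] by apply/imsetP; exists 1; rewrite ?mulr1.
  have [E|[E|E]] := (hr _).1 (principal_right x); last 2 first.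
  - by rewrite E (negPf xN) in xin.
  - by rewrite E (negPf x0) in xin.
  by have : 1 \in [set x * r | r : R] by [rewrite E inE]; case/imsetP=> y _ ->; exists y.
have [z hz] : exists z, z * x = 1.
  have xin : x \in [set r * x | r : R] by apply/imsetP; exists 1; rewrite ?mul1r.
  have [E|[E|E]] := (hl _).1 (principal_left x); last 2 first.
  - by rewrite E (negPf xN) in xin.
  - by rewrite E (negPf x0) in xin.
  by have : 1 \in [set r * x | r : R] by [rewrite E inE]; case/imsetP=> z _ ->; exists z.
by exists y => //; rewrite -[y]mul1r -hz -(mulrA z) hy mulr1 hz.
Qed.

Lemma rad_mulr_eq0 b r : b \in N -> b != 0 -> (b * r == 0) = (r \in N).
Proof.
move=> bN b0; apply/eqP/idP => [E|rN]; last exact: rad_mul0.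
apply: contraNT b0 => /unit_inv[y ry _].
by rewrite -[b]mulr1 -ry mulrA E mul0r.
Qed.

Lemma rad_mulr_eq b r t : b \in N -> b != 0 -> (b * r == b * t) = (r - t \in N).
Proof. by move=> bN b0; rewrite -subr_eq0 -mulrBr rad_mulr_eq0. Qed.

(** The right ideal generated by [b] is nonzero and lies inside [N], so it is [N]. *)
Lemma rad_gen b w : b \in N -> b != 0 -> w \in N -> exists r, b * r = w.
Proof.
move=> bN b0 wN; case: chainN => hr _ _ /eqP NT _.
have bin : b \in [set b * r | r : R] by apply/imsetP; exists 1; rewrite ?mulr1.
have [E|[E|E]] := (hr _).1 (principal_right b); last 2 first.
- by move: wN; rewrite -E => /imsetP[r _ ->]; exists r.
- by rewrite E inE (negPf b0) in bin.
case: NT; apply/setP => x; rewrite inE.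
have : x \in [set b * r | r : R] by rewrite E inE.
by case/imsetP => r _ ->; apply: rad_mulr.
Qed.

Lemma card_coset z0 : #|[set z | z - z0 \in N]| = #|N|.
Proof.
rewrite -(card_imset (mem N) (addrI z0)); apply: eq_card => z; rewrite inE.
apply/idP/imsetP => [h|[w wN ->]]; last by rewrite addrC addKr.
by exists (z - z0) => //; rewrite addrC subrK.
Qed.

Lemma card_fiber b w : b \in N -> b != 0 -> w \in N -> #|[set z | b * z == w]| = #|N|.
Proof.
move=> bN b0 /(rad_gen bN b0)[r <-]; rewrite -(card_coset r).
by apply: eq_card => z; rewrite !inE rad_mulr_eq.
Qed.

(** Left multiplication by [b] maps the ring onto [N], and its fibres are the cosets of [N]. Taking
    [U] to be [N] gives the order of the ring. *)
Lemma card_mulr_preim b (U : {set R}) : b \in N -> b != 0 -> U \subset N ->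
  #|[set z | b * z \in U]| = (#|U| * #|N|)%N.
Proof.
move=> bN b0 /subsetP UN.
rewrite -sum1dep_card (partition_big (fun z => b * z) (mem U)) //=.
rewrite -sum_nat_const; apply: eq_bigr => u uU.
rewrite sum1dep_card -(card_fiber bN b0 (UN _ uU)); apply: eq_card => z; rewrite !inE.
by case: eqP => [->|_]; rewrite ?andbF // uU.
Qed.

Lemma rad_witness : exists2 b, b \in N & b != 0.
Proof.
case: chainN => _ _ N0 _ _.
suff /set0Pn[b] : N :\ 0 != set0 by rewrite !inE => /andP[? ?]; exists b.
apply: contra N0; rewrite setD_eq0 => sub; rewrite eqEsubset sub.
by apply/subsetP => x /set1P->; apply: rad0.
Qed.

Lemma card_ring : #|R| = (#|N| * #|N|)%N.
Proof.
have [b bN b0] := rad_witness.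
rewrite -(card_mulr_preim bN b0 (subxx _)) -cardsT; apply: eq_card => z.
by rewrite !inE rad_mulr.
Qed.

(** * Lines as solution sets of linear equations *)

Lemma free_has_unit (x : vec R) :
  (forall r, vscale x r = vzero R -> r = 0) -> exists i, x i \notin N.
Proof.
move=> fr; have [b bN b0] := rad_witness; apply/existsP.
apply: contraNT b0; rewrite negb_exists => /forallP h; apply/eqP/fr.
by apply/ffunP => i; rewrite !ffunE rad_mul0 //; apply/negPn/h.
Qed.

(** Gaussian elimination: [x i] is the first pivot, and [j] is a unit position of [y] after its
    entry at [i] has been cleared. Scalars act on the right, so the coefficients of the equations
    stand on the left. *)
Lemma line_equation (L : {set vec R}) : is_line L ->
  exists i j : 'I_3, i != j /\
    forall k, exists a b, forall v, v \in L -> v k = a * v i + b * v j.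
Proof.
case/existsP => x /existsP[y /andP[/eqP defL /forallP fr]].
have fr2 a b : vadd (vscale x a) (vscale y b) = vzero R -> a = 0 /\ b = 0.
  by move/eqP => h; have /forallP/(_ b)/implyP/(_ h)/andP[/eqP ? /eqP ?] := fr a.
have [i xi] : exists i, x i \notin N.
  apply: free_has_unit => r h; have [//] : r = 0 /\ 0 = 0 :> R.
  apply: fr2; rewrite h; apply/ffunP => k; rewrite !ffunE mulr0 addr0 //.
have [r xr rx] := unit_inv xi.
have [j yj] : exists j, y j - x j * r * y i \notin N.
  have [|j] := @free_has_unit [ffun k => y k - x k * r * y i].
    (* The cleared vector inherits freeness: a relation on it is a relation on [x] and [y]. *)
    move=> t /ffunP h; have [] // : - (r * y i * t) = 0 /\ t = 0.
    apply: fr2; apply/ffunP => k; have := h k; rewrite !ffunE => <-.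
    by rewrite mulrBl mulrN !mulrA addrC.
  by rewrite ffunE; exists j.
have ij : i != j.
  apply: contra yj => /eqP <-; rewrite xr mul1r subrr; exact: rad0.
have [t yt ty] := unit_inv yj.
exists i, j; split => // k.
pose f := (y k - x k * r * y i) * t.
exists (x k * r - f * (x j * r)), f => v.
rewrite defL => /imset2P[a b _ _ ->]; rewrite !ffunE.
have E1 l : x l * a + y l * b = x l * r * (x i * a + y i * b) + (y l - x l * r * y i) * b.
  rewrite mulrDr mulrBl !mulrA -(mulrA (x l) r (x i)) rx mulr1.
  by rewrite -!addrA; congr (_ + _); rewrite addrCA subrr addr0.
have E2 : (y k - x k * r * y i) * b = f * ((y j - x j * r * y i) * b).
  by rewrite /f -(mulrA _ t) (mulrA t) ty mul1r.
rewrite [LHS]E1 (E1 j) E2.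
move: (x i * a + y i * b) ((y j - x j * r * y i) * b) => V W.
by rewrite mulrDr mulrBl !mulrA addrA subrK.
Qed.

(** * Coordinate charts on the point set *)

Definition mkvec (a b c : R) : vec R := [ffun i : 'I_3 => nth 0 [:: a; b; c] i].
Definition span (v : vec R) : {set vec R} := [set vscale v r | r : R].

Local Notation o0 := (@Ordinal 3 0 isT).
Local Notation o1 := (@Ordinal 3 1 isT).
Local Notation o2 := (@Ordinal 3 2 isT).

(** Normal forms with the first unit coordinate scaled to 1. Once the coordinates before the 1 are
    restricted to [N], the third chart is the class x0 of (0:0:1), the second is the rest of d, and
    the first is everything else. *)
Definition chart1 (p : R * R) := span (mkvec 1 p.1 p.2).
Definition chart2 (p : R * R) := span (mkvec p.1 1 p.2).
Definition chart3 (p : R * R) := span (mkvec p.1 p.2 1).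

Lemma mem_span v : v \in span v.
Proof. by apply/imsetP; exists 1 => //; apply/ffunP => i; rewrite !ffunE mulr1. Qed.

Lemma span_sub a b c a' b' c' : span (mkvec a b c) = span (mkvec a' b' c') ->
  exists r, [/\ a' = a * r, b' = b * r & c' = c * r].
Proof.
move=> E; have := mem_span (mkvec a' b' c'); rewrite -E => /imsetP[r _ /ffunP h].
by exists r; have := (h o0, h o1, h o2); rewrite !ffunE /= => -[[-> ->] ->].
Qed.

Lemma span_point a b c : [|| a == 1, b == 1 | c == 1] -> is_point (span (mkvec a b c)).
Proof.
move=> h1; apply/existsP; exists (mkvec a b c); rewrite eqxx /=.
apply/forallP => r; apply/implyP => /eqP/ffunP h.
have := (h o0, h o1, h o2); rewrite !ffunE /= => -[[h0 h1'] h2].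
by case/or3P: h1 => /eqP E; [move: h0 | move: h1' | move: h2]; rewrite E mul1r => ->.
Qed.

Lemma chart1_inj : injective chart1.
Proof. by move=> [y z] [y' z'] /span_sub[r /=]; rewrite !mul1r => -[<- -> ->]; rewrite !mulr1. Qed.

Lemma chart2_inj : injective chart2.
Proof. by move=> [y z] [y' z'] /span_sub[r /=]; rewrite !mul1r => -[-> <- ->]; rewrite !mulr1. Qed.

Lemma chart3_inj : injective chart3.
Proof. by move=> [y z] [y' z'] /span_sub[r /=]; rewrite !mul1r => -[-> -> <-]; rewrite !mulr1. Qed.

Lemma chart12_neq p p' : p.1 \in N -> chart2 p <> chart1 p'.
Proof.
move=> pN /span_sub[r [E _ _]]; have /negP := rad1F; apply.
by rewrite E rad_mulr.
Qed.

Lemma chart13_neq p p' : p.1 \in N -> chart3 p <> chart1 p'.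
Proof.
move=> pN /span_sub[r [E _ _]]; have /negP := rad1F; apply.
by rewrite E rad_mulr.
Qed.

Lemma chart23_neq p p' : p.2 \in N -> chart3 p <> chart2 p'.
Proof.
move=> pN /span_sub[r [_ E _]]; have /negP := rad1F; apply.
by rewrite E rad_mulr.
Qed.

Lemma subset_of_card (T : finType) (A : {set T}) k : (k <= #|A|)%N ->
  exists2 B : {set T}, B \subset A & #|B| = k.
Proof.
move=> kA; exists [set x in take k (enum A)].
  by apply/subsetP => x; rewrite inE => /mem_take; rewrite mem_enum.
by rewrite cardsE (card_uniqP _) ?take_uniq ?enum_uniq // size_takel // -cardE.
Qed.

Lemma proj_arc_sub (S : {set {set vec R}}) k m n :
  proj_arc S m n -> (k <= m)%N -> exists S' : {set {set vec R}}, proj_arc S' k n.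
Proof.
case/and3P => /forallP hP /eqP cS /forallP hL km.
have [S' S'S cS'] : exists2 S' : {set {set vec R}}, S' \subset S & #|S'| = k.
  by apply: subset_of_card; rewrite cS.
exists S'; apply/and3P; split; last 2 first.
- by rewrite cS'.
- apply/forallP => L; apply/implyP => /(implyP (hL L)); apply: leq_trans.
  apply: subset_leq_card; apply/subsetP => x; rewrite !inE => /andP[xS ->].
  by rewrite (subsetP S'S).
apply/forallP => P; apply/implyP => /(subsetP S'S); exact: (implyP (hP P)).
Qed.

Lemma card_graph (D : {set R * R}) (I : pred (R * R)) (f g : R -> R) :
  (forall p, p \in D -> I p -> exists t, p = (f t, g t)) ->
  (#|[set p in D | I p]| <= #|[set t | (f t, g t) \in D]|)%N.
Proof.
move=> h; have sub : [set p in D | I p] \subset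
    [set (f t, g t) | t in [set t | (f t, g t) \in D]].
  apply/subsetP => p; rewrite inE => /andP[pD pI]; have [t E] := h p pD pI.
  by apply/imsetP; exists t; rewrite ?inE -?E.
exact: leq_trans (subset_leq_card sub) (leq_imset_card _ _).
Qed.

(** * From bounds in the charts to an arc *)

Section Charts.
Variables (D1 D2 D3 : {set R * R}) (n : nat).
Hypotheses (D2N : forall p, p \in D2 -> p.1 \in N)
  (D3N : forall p, p \in D3 -> p.1 \in N /\ p.2 \in N).
(** The three kinds of lines are z = ax + by, then y = ax + bz with b in [N], then x = ay + bz with
    a and b in [N]. Each kind misses one chart, so only two counts occur in each bound. *)
Hypothesis transversal_line : forall a b : R,
  (#|[set y | (y, (a + b * y)%R) \in D1]| + #|[set x | (x, (a * x + b)%R) \in D2]| <= n)%N.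
Hypothesis pencil_line : forall a b : R, b \in N ->
  (#|[set z | ((a + b * z)%R, z) \in D1]| + #|[set x | (x, (a * x + b)%R) \in D3]| <= n)%N.
Hypothesis infinite_line : forall a b, a \in N -> b \in N ->
  (#|[set z | ((a + b * z)%R, z) \in D2]| + #|[set y | ((a * y + b)%R, y) \in D3]| <= n)%N.

Let S := chart1 @: D1 :|: chart2 @: D2 :|: chart3 @: D3.

Lemma card_charts : #|S| = (#|D1| + #|D2| + #|D3|)%N.
Proof.
have I12 : chart1 @: D1 :&: chart2 @: D2 = set0.
  apply/setP => P; rewrite in_setI in_set0; apply/andP.
  move=> [/imsetP[p _ ->] /imsetP[p' pD' E]].
  by case: (chart12_neq (p' := p) (D2N pD')); rewrite E.
have I3 : (chart1 @: D1 :|: chart2 @: D2) :&: chart3 @: D3 = set0.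
  apply/setP => P; rewrite in_setI in_set0; apply/andP.
  move=> [/setUP[] /imsetP[p _ ->] /imsetP[p' pD' E]].
    by case: (chart13_neq (p' := p) (D3N pD').1); rewrite E.
  by case: (chart23_neq (p' := p) (D3N pD').2); rewrite E.
rewrite cardsU I3 cardsU I12 cards0 !subn0.
by rewrite !card_imset; [|apply: chart3_inj|apply: chart2_inj|apply: chart1_inj].
Qed.

Definition on_eq (a b c : R) (v : vec R) := a * v o0 + b * v o1 + c * v o2 == 0.

(** The equation is solved for the last coordinate with a unit coefficient. The chart in which that
    coordinate is 1 contributes nothing, since the equation would put 1 into [N]. *)
Lemma card_charts_line a b c : [\/ c = -1, b = -1 | a = -1] ->
  (#|[set p in D1 | on_eq a b c (mkvec 1%R p.1 p.2)]|
   + #|[set p in D2 | on_eq a b c (mkvec p.1 1%R p.2)]|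
   + #|[set p in D3 | on_eq a b c (mkvec p.1 p.2 1%R)]| <= n)%N.
Proof.
move=> abc; have m1N : (-1 : R) \notin N.
  by apply: contra rad1F => /rad_opp; rewrite opprK.
have [cN|/unit_inv[c' cc' c'c]] := boolP (c \in N); last first.
  have solve x y z : (a * x + b * y + c * z == 0) -> z = - (c' * a) * x + - (c' * b) * y.
    rewrite addrC addr_eq0 => /eqP E; rewrite -[z]mul1r -c'c -mulrA E.
    by rewrite mulrN mulrDr !mulNr !mulrA opprD.
  rewrite [X in (_ + X <= _)%N](_ : _ = 0)%N ?addn0; last first.
    apply/eqP; rewrite cards_eq0 -subset0; apply/subsetP => p.
    rewrite inE /on_eq !ffunE /= => /andP[/D3N[xN yN] /solve E].
    by have := rad1F; rewrite E rad_add ?rad_mull.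
  apply: leq_trans (transversal_line (- (c' * a)) (- (c' * b))).
  rewrite leq_add //.
    apply: (card_graph (f := id)) => -[y z] _; rewrite /on_eq !ffunE /=.
    by move/solve => ->; exists y; rewrite mulr1.
  apply: (card_graph (f := id)) => -[x z] _; rewrite /on_eq !ffunE /=.
  by move/solve => ->; exists x; rewrite mulr1.
have [bN|/unit_inv[b' bb' b'b]] := boolP (b \in N); last first.
  have solve x y z : (a * x + b * y + c * z == 0) -> y = - (b' * a) * x + - (b' * c) * z.
    rewrite addrAC addrC addr_eq0 => /eqP E; rewrite -[y]mul1r -b'b -mulrA E.
    by rewrite mulrN mulrDr !mulNr !mulrA opprD.
  have dN : - (b' * c) \in N by rewrite rad_opp ?rad_mull.
  rewrite [X in (_ + X + _ <= _)%N](_ : _ = 0)%N ?addn0; last first.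
    apply/eqP; rewrite cards_eq0 -subset0; apply/subsetP => p.
    rewrite inE /on_eq !ffunE /= => /andP[/D2N xN /solve E].
    by have := rad1F; rewrite E (rad_add (rad_mull _ xN) (rad_mulr _ dN)).
  apply: leq_trans (pencil_line (- (b' * a)) dN).
  rewrite leq_add //.
    apply: (card_graph (g := id)) => -[y z] _; rewrite /on_eq !ffunE /=.
    by move/solve => ->; exists z; rewrite mulr1.
  apply: (card_graph (f := id)) => -[x y] _; rewrite /on_eq !ffunE /=.
  by move/solve => ->; exists x; rewrite mulr1.
have aE : a = -1 by case: abc => // E; move: m1N; rewrite -E ?cN ?bN.
have solve x y z : (a * x + b * y + c * z == 0) -> x = b * y + c * z.
  by rewrite aE mulN1r -addrA addrC subr_eq0 eq_sym => /eqP.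
rewrite [X in (X + _ + _ <= _)%N](_ : _ = 0)%N ?add0n; last first.
  apply/eqP; rewrite cards_eq0 -subset0; apply/subsetP => p.
  rewrite inE /on_eq !ffunE /= => /andP[_ /solve E].
  by have := rad1F; rewrite E rad_add ?rad_mulr.
apply: leq_trans (infinite_line bN cN).
rewrite leq_add //.
  apply: (card_graph (g := id)) => -[x z] _; rewrite /on_eq !ffunE /=.
  by move/solve => ->; exists z; rewrite mulr1.
apply: (card_graph (g := id)) => -[x y] _; rewrite /on_eq !ffunE /=.
by move/solve => ->; exists y; rewrite mulr1.
Qed.

Lemma arc_of_charts k : (k <= #|D1| + #|D2| + #|D3|)%N ->
  exists S' : {set {set vec R}}, proj_arc S' k n.
Proof.
rewrite -card_charts; apply: (proj_arc_sub (S := S)); apply/and3P; split => //.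
  apply/forallP => P; apply/implyP => /setUP[/setUP[]|] /imsetP[p _ ->];
  by rewrite span_point ?eqxx ?orbT.
apply/forallP => L; apply/implyP => /line_equation[i [j [ij hL]]].
(* The coordinate other than [i] and [j] is a combination of these two; moving it across gives it
   the coefficient -1. *)
have [a [b [c [abc Lsub]]]] : exists a b c, [\/ c = -1, b = -1 | a = -1] /\
    forall v, v \in L -> on_eq a b c v.
  have e0 (l : (0 < 3)%N) : Ordinal l = o0 by apply: val_inj.
  have e1 (l : (1 < 3)%N) : Ordinal l = o1 by apply: val_inj.
  have e2 (l : (2 < 3)%N) : Ordinal l = o2 by apply: val_inj.
  move: hL ij; case: i => [[|[|[|//]]] li]; case: j => [[|[|[|//]]] lj] hL ij //;
  rewrite ?e0 ?e1 ?e2 in hL.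
  - have [a [b h]] := hL o2; exists a, b, (-1); split; first by constructor.
    by move=> v /h E; rewrite /on_eq E mulN1r subrr.
  - have [a [b h]] := hL o1; exists a, (-1), b; split; first by constructor.
    by move=> v /h E; rewrite /on_eq E mulN1r addrAC subrr.
  - have [a [b h]] := hL o2; exists b, a, (-1); split; first by constructor.
    by move=> v /h E; rewrite /on_eq E mulN1r addrC [a * _ + _]addrC addNr.
  - have [a [b h]] := hL o0; exists (-1), a, b; split; first by constructor.
    by move=> v /h E; rewrite /on_eq E mulN1r -addrA addNr.
  - have [a [b h]] := hL o1; exists b, (-1), a; split; first by constructor.
    by move=> v /h E; rewrite /on_eq E mulN1r [a * _ + _]addrC addrAC subrr.
  - have [a [b h]] := hL o0; exists (-1), b, a; split; first by constructor.
    by move=> v /h E; rewrite /on_eq E mulN1r -addrA [a * _ + _]addrC addNr.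
apply: leq_trans (card_charts_line abc).
have sub : [set P in S | P \subset L] \subset
    chart1 @: [set p in D1 | on_eq a b c (mkvec 1 p.1 p.2)]
    :|: chart2 @: [set p in D2 | on_eq a b c (mkvec p.1 1 p.2)]
    :|: chart3 @: [set p in D3 | on_eq a b c (mkvec p.1 p.2 1)].
  apply/subsetP => P; rewrite inE => /andP[/setUP[/setUP[]|] /imsetP[p pD ->] /subsetP PL].
  - apply/setUP; left; apply/setUP; left; apply/imsetP; exists p => //.
    by rewrite inE pD Lsub // PL // mem_span.
  - apply/setUP; left; apply/setUP; right; apply/imsetP; exists p => //.
    by rewrite inE pD Lsub // PL // mem_span.
  - apply/setUP; right; apply/imsetP; exists p => //.
    by rewrite inE pD Lsub // PL // mem_span.
apply: leq_trans (subset_leq_card sub) _.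
apply: leq_trans (leq_card_setU _ _) _; rewrite leq_add ?leq_imset_card //.
apply: leq_trans (leq_card_setU _ _) _; rewrite leq_add ?leq_imset_card //.
Qed.

End Charts.

End ChainRing.

Lemma sum_bool_card (T : finType) (A : {set T}) (P : pred T) :
  (\sum_(u in A) P u = #|[set u in A | P u]|)%N.
Proof. by rewrite -sum1dep_card big_mkcondr; apply: eq_bigr => u _; case: (P u). Qed.

(** * The arc, written as the complement of the blocking set in each chart *)

Section Construction.
Variables (R : finNzRingType) (N : {set R}).
Hypothesis chainN : chain_ring2 N.
Variables (th g : R) (Y : {set R}).
Hypotheses (thN : th \in N) (th0 : th != 0).
Hypotheses (gN : g \in N) (g0 : g != 0) (gth : g != th).
Hypotheses (YN : Y \subset N) (Y0 : 0 \notin Y) (Yth : th \notin Y).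

Let radM := rad_mulr chainN.
Let radMl := rad_mull chainN.
Let radD := rad_add chainN.
Let radB := rad_sub chainN.
Let rad00 := rad_mul0 chainN.

(* [rep u] is a preimage of [u] under multiplication by [th] (0 if [u] is not in [N]),
   so [rho z] is a fixed representative of [z] modulo [N]. *)
Definition rep (u : R) : R := odflt 0 [pick r | th * r == u].
Definition rho (z : R) : R := rep (th * z).
(** The displacement between the two segments of a point class on a line class from [Y]. It is never
    0, so the segments differ, and it takes every nonzero value of [N], so every parallel line is
    met. *)
Definition omega (z : R) : R := if th * z == 0 then th else th * z.

Lemma repK u : u \in N -> th * rep u = u.
Proof.
move=> /(rad_gen chainN thN th0)[r rE]; rewrite /rep; case: pickP => [s /eqP //|/(_ r)].
by rewrite rE eqxx.
Qed.

Lemma th_rho z : th * rho z = th * z.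
Proof. by rewrite repK ?radM. Qed.

Lemma rho_id z : rho (rho z) = rho z.
Proof. by rewrite {1}/rho th_rho. Qed.

Lemma rho_rad z : rho z - z \in N.
Proof. by rewrite -(rad_mulr_eq chainN _ _ thN th0) th_rho. Qed.

Lemma th_addr y w : w \in N -> th * (y + w) = th * y.
Proof. by move=> wN; rewrite mulrDr (rad00 thN wN) addr0. Qed.

Lemma th_eq0 z : (th * z == 0) = (z \in N).
Proof. exact: rad_mulr_eq0. Qed.

Lemma omega_rad z : omega z \in N.
Proof. by rewrite /omega; case: ifP; rewrite ?radM. Qed.

Lemma omega_neq0 z : omega z != 0.
Proof. by rewrite /omega; case: ifPn. Qed.

Lemma card_reps : #|[set z | rho z == z]| = #|N|.
Proof.
rewrite -(@card_in_imset _ _ rep (mem N)).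
  apply: eq_card => z; rewrite inE; apply/eqP/imsetP => [<-|[u uN ->]].
    by exists (th * z); rewrite ?radM.
  by rewrite /rho repK.
by move=> u v uN vN E; rewrite -(repK uN) E repK.
Qed.

Lemma card_affine_reps c d : c \notin N ->
  #|[set z | rho (c * z + d) == c * z + d]| = #|N|.
Proof.
case/(unit_inv chainN) => c' cc' c'c; rewrite -card_reps.
rewrite -(@on_card_preimset _ _ (fun z => c * z + d) [set z | rho z == z]).
  by apply: eq_card => z; rewrite !inE.
exists (fun w => c' * (w - d)) => z _; first by rewrite addrK mulrA c'c mul1r.
by rewrite mulrA cc' mul1r subrK.
Qed.

(* The blocking set on d: (x : 1 : z) belongs to it iff [x \in avoid z].  The residues
   0 and [th * z] are the pencils of lines through two points of the dual affine
   plane; [th * z * z] blocks a second time the lines [x = b * z] with [b] outside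
   [full], on which both pencils use the same segment.  In the classes 0 and 1 of [z], [th] and
   [g] only pad the set to three elements. *)
Definition avoid (z : R) : {set R} :=
  if th * z \in Y then [set 0; th * z]
  else if (th * z == 0) || (th * z == th) then [set 0; th; g]
  else [set 0; th * z; th * z * z].

(* The s - 2 line classes through x0 with two segments per point class are those with
   [th * y \in Y]; for the others, z_m is the class of (0 : 1 : rho y). *)
Definition arc1 : {set R * R} := [set p | if th * p.1 \in Y
  then (p.1 != rho p.1) && (p.1 != rho p.1 + omega p.2)
  else rho (p.2 - rho p.1 * p.1) != p.2 - rho p.1 * p.1].
Definition arc2 : {set R * R} := [set p | (p.1 \in N) && (p.1 \notin avoid p.2)].
(* The segments x = const of the class x0 that lie in the blocking set. *)
Definition full : {set R} := 0 |: (th |: Y).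
Definition arc3 : {set R * R} := setX (N :\: full) N.

(** * Blocked points on each kind of line *)

Lemma full_rad : full \subset N.
Proof. by rewrite !subUset !sub1set (rad0 chainN) thN. Qed.

Lemma card_full : #|full| = (#|Y| + 2)%N.
Proof.
rewrite !cardsU1 !inE (negPf Y0) (negPf Yth) orbF [0 == th]eq_sym (negPf th0).
by rewrite addnA addnC.
Qed.

Lemma avoid_rad z : avoid z \subset N.
Proof.
have thz := radM z thN; have thzz := radM z thz.
rewrite /avoid; do 2?case: ifP => _;
by rewrite !subUset !sub1set ?thz ?thzz ?thN ?gN (rad0 chainN).
Qed.

(** The quadratic entry also depends only on the residue class: [th * z * w] is a product of two
    elements of [N]. *)
Lemma avoid_addr z w : w \in N -> avoid (w + z) = avoid z.
Proof.
move=> wN; have E : th * (w + z) = th * z by rewrite addrC th_addr.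
by rewrite /avoid !E -!mulrA mulrDr mulrDr (rad00 thN (radMl _ wN)) add0r.
Qed.

Lemma avoid0 z : 0 \in avoid z.
Proof. by rewrite /avoid; do 2?case: ifP => _; rewrite !inE eqxx. Qed.

Lemma avoid_th z : th * z \in avoid z.
Proof.
rewrite /avoid; case: ifP => _; first by rewrite !inE eqxx orbT.
by case: ifP => [|_]; rewrite !inE ?eqxx ?orbT // => ->.
Qed.

Lemma card_avoid z : #|avoid z| = (2 + (th * z \notin Y)%R)%N.
Proof.
have set3 a b c : a != b -> c != a -> c != b -> #|[set a; b; c] : {set R}| = 3%N.
  move=> ab ca cb; rewrite setUC cardsU1 !inE (negPf ca) (negPf cb).
  by rewrite cards2 ab.
rewrite /avoid; case: ifPn => zY /=.
  by rewrite cards2 eq_sym; case: eqP => // E; rewrite E (negPf Y0) in zY.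
case: ifPn => [_|]; first by rewrite set3 // eq_sym.
rewrite negb_or => /andP[z0 z1]; have zN : z \notin N by rewrite -th_eq0.
rewrite set3 //; first by rewrite eq_sym.
  by rewrite (rad_mulr_eq0 chainN _ (radM z thN) z0).
have [z' zz' _] := unit_inv chainN zN.
apply: contra z1 => /eqP/(congr1 (fun x => x * z')).
by rewrite -!mulrA zz' !mulr1 => ->.
Qed.

(** The line is blocked twice in each class from [Y] and once in each other class, except possibly
    in the class [th * b], where it is parallel to the segments. If that class is not in [Y], the
    third element of [avoid b] makes up for the loss. *)
Lemma card_line_transversal a b :
  (#|[set y | (y, (a + b * y)%R) \in arc1]| +
   #|[set x | (x, (a * x + b)%R) \in arc2]| + (#|Y| + 2) <= #|N| * #|N|)%N.
Proof.
have E2 : [set x | (x, (a * x + b)%R) \in arc2] = N :\: avoid b.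
  apply/setP => x; rewrite !inE /= andbC; case: (boolP (x \in N)) => xN; rewrite ?andbF //.
  by rewrite avoid_addr ?radMl.
have c2 := cardsID (avoid b) N.
rewrite (setIidPr (avoid_rad b)) card_avoid in c2.
have c1 := cardsC [set y | (y, (a + b * y)%R) \in arc1].
rewrite (card_ring chainN) in c1; rewrite {}E2.
set B := ~: _ in c1.
have BE : #|B| = (\sum_(u in N) #|[set y in B | (th * y == u)%R]|)%N.
  rewrite -sum1_card (partition_big (fun y => th * y) (mem N)); last by move=> y _; apply: radM.
  by apply: eq_bigr => u uN; rewrite -sum1dep_card.
have fib u : u \in N ->
    ((u \in Y) + ((u \in Y) || (u != th * b)%R) <= #|[set y in B | (th * y == u)%R]|)%N.
  move=> uN; set r := rep u; have thr : th * r = u by apply: repK.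
  have [uY|uY] /= := boolP (u \in Y).
    have w0 := omega_neq0 (a + b * r); have wN := omega_rad (a + b * r).
    set w := omega _ in w0 wN.
    apply: leq_trans (subset_leq_card (_ : [set r; r + w] \subset _)).
      by rewrite cards2 -{1}[r]addr0 (inj_eq (addrI r)) eq_sym w0.
    apply/subsetP => y; rewrite !inE /=.
    have [thy|] : th * y = u \/ th * y <> u by case: (eqVneq (th * y) u) => [|/eqP]; [left|right].
      rewrite thy uY eqxx andbT negb_and !negbK /rho thy -/r => /orP[->//|/eqP yE].
      apply/orP; right; rewrite {1}yE; apply/eqP; congr (_ + _); rewrite /w /omega yE.
      have -> : th * (a + b * (r + w)) = th * (a + b * r) => //.
      by rewrite (mulrDr b) addrA th_addr // radMl.
    by move=> thy /orP[] /eqP yE; case: thy; rewrite yE ?th_addr.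
  rewrite add0n; case: (eqVneq u (th * b)) => [//|ub]; rewrite card_gt0.
  have brN : b - r \notin N by rewrite -(rad_mulr_eq chainN _ _ thN th0) thr eq_sym.
  have [c bc cb] := unit_inv chainN brN.
  (* Moving from [r] inside its class changes [a + (b - r) * y] by any prescribed element of [N];
     this [y] takes it from [v] to the representative [rho v]. *)
  pose v := a + (b - r) * r; pose y := r + c * (rho v - v).
  have thy : th * y = u by rewrite th_addr // radMl // rho_rad.
  apply/set0Pn; exists y; rewrite !inE /= thy eqxx (negPf uY) andbT negbK.
  have -> : rho y = r by rewrite /rho thy.
  suff -> : a + b * y - r * y = rho v by rewrite rho_id.
  by rewrite -addrA -mulrBl /y mulrDr mulrA bc mul1r addrA -/v addrC subrK.
have : (#|Y| + (#|N| - (th * b \notin Y)%R) <= #|B|)%N.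
  rewrite BE.
  apply: (@leq_trans (\sum_(u in N) ((u \in Y) + ((u \in Y) || (u != th * b)%R))%N)); last first.
    exact: leq_sum.
  rewrite big_split /= !sum_bool_card leq_add //.
    by apply: subset_leq_card; apply/subsetP => u uY; rewrite inE uY (subsetP YN).
  have [bY|bY] /= := boolP (th * b \in Y).
    rewrite subn0; apply: subset_leq_card; apply/subsetP => u uN; rewrite inE uN /=.
    by case: (eqVneq u) => [->|]; rewrite ?bY ?orbT.
  rewrite (cardsD1 (th * b)) (radM _ thN) addKn; apply: subset_leq_card.
  by apply/subsetP => u; rewrite !inE => /andP[-> ->]; rewrite orbT.
move: c1 c2; case: (th * b \notin Y) => /=;
  move: #|[set y | _]| #|N :\: _| #|B| #|Y| #|N| => m1 m2 m3 m4 m5; clear; lia.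
Qed.

(** Each segment in x0 blocks one point, which accounts for [#|Y| + 2]. It remains to find [#|N|]
    blocked points in the first chart, all of them in classes on the one line class [th * a]. *)
Lemma card_line_pencil a b : b \in N ->
  (#|[set z | ((a + b * z)%R, z) \in arc1]| +
   #|[set x | (x, (a * x + b)%R) \in arc3]| + (#|Y| + 2) <= #|N| * #|N|)%N.
Proof.
move=> bN.
have E3 : [set x | (x, (a * x + b)%R) \in arc3] = N :\: full.
  apply/setP => x; rewrite inE in_setX /=; case: (boolP (x \in N :\: full)) => //= xF.
  by rewrite radD // radMl //; case/setDP: xF.
have c3 := cardsID full N; rewrite (setIidPr full_rad) card_full in c3.
have c1 := cardsC [set z | ((a + b * z)%R, z) \in arc1].
rewrite (card_ring chainN) in c1; rewrite {}E3.
suff : (#|N| <= #|~: [set z | ((a + b * z)%R, z) \in arc1]|)%N.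
  move: c1 c3; move: #|~: _| #|[set z | _]| #|N :\: _| #|Y| #|N| => m1 m2 m3 m4 m5; clear; lia.
have thE z : th * (a + b * z) = th * a by rewrite th_addr ?radM.
have rhoE z : rho (a + b * z) = rho a by rewrite /rho thE.
have raN := rho_rad a.
case: (boolP (th * a \in Y)) => aY; last first.
  rewrite -(card_affine_reps (- (rho a * a)) (_ : 1 - rho a * b \notin N)); last first.
    apply: contra (rad1F chainN) => /radD/(_ (radMl (rho a) bN)).
    by rewrite subrK.
  apply: subset_leq_card; apply/subsetP => z; rewrite !inE /= thE (negPf aY) rhoE negbK.
  by rewrite mulrBl mul1r -mulrA mulrDr opprD addrAC addrA.
have [bz|b0] := eqVneq b 0; last first.
  rewrite -(card_fiber chainN bN b0 raN); apply: subset_leq_card; apply/subsetP => z.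
  by rewrite !inE /= thE aY rhoE => /eqP->; rewrite addrC subrK eqxx.
have [ra|ra] := eqVneq a (rho a).
  rewrite [~: _](_ : _ = setT) ?cardsT ?max_card //; apply/setP => z.
  by rewrite !inE /= thE aY rhoE bz mul0r addr0 -ra eqxx.
(* The line misses every first segment, but coincides with the second one wherever [th * z] equals
   the nonzero offset [a - rho a]. *)
have arN : a - rho a \in N by rewrite -opprB rad_opp.
rewrite -(card_fiber chainN thN th0 arN); apply: subset_leq_card; apply/subsetP => z.
rewrite !inE /= thE aY rhoE bz mul0r addr0 /omega => /eqP->.
by rewrite subr_eq0 (negPf ra) addrC subrK eqxx.
Qed.

(** In x0 the line is the segment x = [b]. If [b] is in [full], that segment is blocked and [#|N|]
    blocked points in the second chart suffice; otherwise [2 * #|N|] are needed there. *)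
Lemma card_line_infinite a b : a \in N -> b \in N -> (#|Y| + 2 <= #|N|)%N ->
  (#|[set z | ((a + b * z)%R, z) \in arc2]| +
   #|[set y | ((a * y + b)%R, y) \in arc3]| + (#|Y| + 2) <= #|N| * #|N|)%N.
Proof.
move=> aN bN cY.
have c2 := cardsC [set z | ((a + b * z)%R, z) \in arc2].
rewrite (card_ring chainN) in c2; set B := ~: _ in c2.
have inB z : a + b * z \in avoid z -> z \in B.
  by move=> h; rewrite !inE /= h andbF.
have zeroB z : b * z = - a -> z \in B.
  by move=> E; apply: inB; rewrite E subrr avoid0.
have naN : - a \in N by rewrite rad_opp.
have c3 : (#|[set y | ((a * y + b)%R, y) \in arc3]| <= #|N|)%N.
  apply: subset_leq_card; apply/subsetP => y; rewrite inE in_setX => /andP[_ //].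
have [bF|bF] := boolP (b \in full).
  have -> : [set y | ((a * y + b)%R, y) \in arc3] = set0.
    apply/setP => y; rewrite inE in_set0 in_setX /=; apply/andP => -[h yN].
    by move: h; rewrite (rad00 aN yN) add0r in_setD bF.
  suff : (#|N| <= #|B|)%N.
    rewrite cards0; move: c2 cY; move: #|B| #|[set z | _]| #|Y| #|N| => m1 m2 m3 m4; clear; lia.
  have [bz|b0] := eqVneq b 0.
    rewrite -(card_fiber chainN thN th0 aN); apply: subset_leq_card; apply/subsetP => z.
    by rewrite inE => /eqP E; apply: inB; rewrite bz mul0r addr0 -E avoid_th.
  rewrite -(card_fiber chainN bN b0 naN); apply: subset_leq_card; apply/subsetP => z.
  by rewrite inE => /eqP/zeroB.
suff : (#|N| + #|N| <= #|B|)%N.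
  move: c2 c3 cY; move: #|B| #|[set z | _]| #|[set y | _]| #|Y| #|N| => m1 m2 m3 m4 m5; clear; lia.
move: (bF); rewrite !inE !negb_or => /and3P[b0 bth bY].
have bthN : b - th \in N by apply: radB.
have bth0 : b - th != 0 by rewrite subr_eq0.
(* For nonzero [a], the points with x = 0 and those with x = [th * z] form two disjoint families of
   size [#|N|]. *)
have [az|a0] := eqVneq a 0; last first.
  rewrite -{1}(card_fiber chainN bN b0 naN) -(card_fiber chainN bthN bth0 naN).
  rewrite -cardsUI [_ :&: _](_ : _ = set0) ?cards0 ?addn0.
    apply: subset_leq_card; apply/subsetP => z; rewrite in_setU => /orP[|].
      by rewrite inE => /eqP/zeroB.
    rewrite inE => /eqP E; apply: inB; suff -> : a + b * z = th * z by apply: avoid_th.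
    by move: E; rewrite mulrBl => /eqP; rewrite subr_eq => /eqP->; rewrite addrA subrr add0r.
  apply/setP => z; rewrite !inE mulrBl; apply/andP => -[/eqP E].
  rewrite E -subr_eq0 addrAC subrr add0r oppr_eq0 th_eq0 => zN.
  by move: E; rewrite (rad00 bN zN) => /esym/eqP; rewrite oppr_eq0 (negPf a0).
(* For [a = 0] both families are the class of [z] in [N]. On the class of [be], x equals
   [th * z * z], which gives the second family. *)
have [be bE] := rad_gen chainN thN th0 bN.
have beN : be \notin N by rewrite -th_eq0 bE.
rewrite -{1}(card_fiber chainN bN b0 naN) -(card_coset N be).
rewrite -cardsUI [_ :&: _](_ : _ = set0) ?cards0 ?addn0.
  apply: subset_leq_card; apply/subsetP => z; rewrite in_setU => /orP[|].
    by rewrite inE => /eqP/zeroB.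
  rewrite inE => zbe; apply: inB; rewrite -[z](subrK be) avoid_addr //.
  rewrite az add0r mulrDr (rad00 bN zbe) add0r /avoid bE (negPf bY) (negPf b0) (negPf bth).
  by rewrite !inE eqxx orbT.
apply/setP => z; rewrite !inE az oppr0 (rad_mulr_eq0 chainN _ bN b0); apply/andP => -[zN zb].
by case/negP: beN; rewrite -[be](subKr z) radB.
Qed.

(** * Size of the construction *)

Lemma card_arc1 : (#|N| ^ 4 <= #|arc1| + (#|N| + #|Y|) * #|N| ^ 2)%N.
Proof.
have cYN := subset_leq_card YN.
have := cardsC arc1; rewrite card_prod (card_ring chainN) => c1.
suff : (#|~: arc1| <= (#|N| + #|Y|) * #|N| ^ 2)%N.
  by rewrite -(leq_add2l #|arc1|) c1; apply: leq_trans; rewrite !expnS expn0; lia.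
(* The complement is covered by three parametrised families: first segments, second segments, and
   the sloped segments of the classes outside [Y]. *)
pose E1 := [set (rep p.1, p.2) | p in setX Y [set: R]].
pose E2 := [set (rep p.1 + omega p.2, p.2) | p in setX Y [set: R]].
pose E3 := [set (rep p.1.1 + p.1.2, rep p.2 + rep p.1.1 * (rep p.1.1 + p.1.2))
             | p in setX (setX (N :\: Y) N) N].
have sub : ~: arc1 \subset E1 :|: E2 :|: E3.
  apply/subsetP => -[y z]; rewrite !in_setU !inE /=.
  case: ifP => yY.
    rewrite negb_and !negbK => /orP[] /eqP E; apply/orP; left; apply/orP; [left|right];
    apply/imsetP; exists (th * y, z); rewrite ?in_setX ?inE ?yY //=; congr (_, _); exact: E.
  rewrite negbK => /eqP E; apply/orP; right; apply/imsetP.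
  exists (th * y, y - rho y, th * (z - rho y * y)).
    by rewrite !in_setX !inE yY /= !radM // -opprB rad_opp // rho_rad.
  by rewrite /= -/(rho y) -/(rho (z - _)) E [rho y + _]addrC !subrK.
apply: leq_trans (subset_leq_card sub) _.
have c1' : (#|E1| <= #|Y| * #|N| ^ 2)%N.
  by apply: leq_trans (leq_imset_card _ _) _; rewrite cardsX cardsT (card_ring chainN) mulnn.
have c2' : (#|E2| <= #|Y| * #|N| ^ 2)%N.
  by apply: leq_trans (leq_imset_card _ _) _; rewrite cardsX cardsT (card_ring chainN) mulnn.
have c3' : (#|E3| <= (#|N| - #|Y|) * #|N| ^ 2)%N.
  apply: leq_trans (leq_imset_card _ _) _; rewrite !cardsX cardsD (setIidPr YN).
  by rewrite -mulnA mulnn.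
apply: leq_trans (leq_card_setU _ _) _.
apply: leq_trans (leq_add (leq_card_setU _ _) (leqnn _)) _.
apply: leq_trans (leq_add (leq_add c1' c2') c3') _.
rewrite -!mulnDl leq_mul2r; apply/orP; right; move: cYN; move: #|Y| #|N| => y m; clear; lia.
Qed.

Lemma card_arc2 : (#|N| ^ 3 + #|Y| * #|N| <= #|arc2| + 3 * #|N| ^ 2)%N.
Proof.
have e2 : #|arc2| = (\sum_(z : R) #|N :\: avoid z|)%N.
  rewrite -sum1_card (partition_big (fun p => p.2) predT) //=.
  apply: eq_bigr => z _; have inj : injective (fun x : R => (x, z)) by move=> x x' [].
  rewrite sum1dep_card -(card_imset (mem (N :\: avoid z)) inj).
  apply: eq_card => -[x z']; rewrite !inE /=.
  apply/andP/imsetP => [[/andP[xN xA] /eqP zz]|[x' + [-> ->]]].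
    by exists x; rewrite -?zz // in_setD xA.
  by rewrite in_setD => /andP[-> ->].
have e3 : (#|arc2| + \sum_(z : R) #|avoid z| = #|N| ^ 3)%N.
  rewrite e2 -big_split /= (eq_bigr (fun _ => #|N|)).
    by rewrite sum_nat_const (card_ring chainN) !expnS expn0 muln1 mulnA.
  move=> z _; rewrite addnC -(cardsID (avoid z) N); congr (_ + _)%N.
  by rewrite (setIidPr (avoid_rad z)).
have e4 : (\sum_(z : R) #|avoid z| + #|Y| * #|N| = 3 * #|N| ^ 2)%N.
  rewrite -(card_mulr_preim chainN thN th0 YN) -sum1dep_card [X in (_ + X)%N]big_mkcond.
  rewrite -big_split /=.
  rewrite (eq_bigr (fun _ => 3)).
    by rewrite sum_nat_const (card_ring chainN) mulnn mulnC.
  by move=> z _; rewrite card_avoid; case: (th * z \in Y).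
by rewrite -e3 -addnA e4.
Qed.

Lemma card_arc3 : (#|arc3| + (#|Y| + 2) * #|N| = #|N| ^ 2)%N.
Proof.
rewrite cardsX -mulnDl -card_full addnC -mulnn; congr (_ * _)%N.
by rewrite -[RHS](cardsID full N) (setIidPr full_rad).
Qed.

(** The lower bounds for the three pieces add up to exactly [#|N| ^ 2 * n - 2 * #|N|]. *)
Lemma large_arc n k : (n + (#|Y| + 2) = #|N| ^ 2)%N ->
  (k + 2 * #|N| <= #|N| ^ 2 * n)%N ->
  exists S : {set {set vec R}}, proj_arc S k n.
Proof.
move=> nE kE; have c3 := card_arc3.
have cY : (#|Y| + 2 <= #|N|)%N.
  have q0 : (0 < #|N|)%N by apply/card_gt0P; exists 0; apply: rad0.
  by rewrite -(leq_pmul2r q0) mulnn -c3 leq_addl.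
apply: (@arc_of_charts _ _ chainN arc1 arc2 arc3).
- by move=> p; rewrite inE => /andP[].
- by case=> x y; rewrite in_setX => /andP[/setDP[xN _] yN].
- move=> a b; rewrite -(leq_add2r (#|Y| + 2)) nE -mulnn; exact: card_line_transversal.
- move=> a b bN; rewrite -(leq_add2r (#|Y| + 2)) nE -mulnn; exact: card_line_pencil.
- move=> a b aN bN; rewrite -(leq_add2r (#|Y| + 2)) nE -mulnn; exact: card_line_infinite.
have := card_arc1; have := card_arc2; move: nE kE c3.
move: #|arc1| #|arc2| #|arc3| #|N| #|Y| => x1 x2 x3 q y nE kE c3 c2 c1.
have e1 : (q ^ 2 * n + q ^ 2 * (y + 2) = q ^ 4)%N by rewrite -mulnDr nE -expnD.
move: e1 kE c3 c2 c1; rewrite !(mulnDl, mulnDr) -expnS [(y * q ^ 2)%N]mulnC; lia.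
Qed.

End Construction.

(** * The case q = 2, and the conclusion *)

Lemma quadrangle_arc (R : finNzRingType) (N : {set R}) :
  chain_ring2 N -> exists S : {set {set vec R}}, proj_arc S 4 2.
Proof.
move=> chainN; have one0 := oner_neq0 R; have N1 := rad1F chainN.
have card_le1 (P : pred R) c : (forall x, P x -> x = c) -> (#|[set x | P x]| <= P c)%N.
  move=> h; case: (boolP (P c)) => Pc /=.
    rewrite -(cards1 c); apply: subset_leq_card; apply/subsetP => x.
    by rewrite inE => /h->; rewrite inE.
  rewrite leqn0 cards_eq0 -subset0; apply/subsetP => x.
  by rewrite inE => Px; move: Pc; rewrite -(h _ Px) Px.
have D1 (f : R -> R * R) c d : (forall x, f x = (0, 0) -> x = c) ->
    (forall x, f x = (1, 1) -> x = d) ->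
    (#|[set x | f x \in [set (0%R, 0%R); (1%R, 1%R)]]| <=
     (f c == (0%R, 0%R)) + (f d == (1%R, 1%R)))%N.
  move=> h0 h1; rewrite (_ : [set x | _] = [set x | f x == (0, 0)] :|: [set x | f x == (1, 1)]).
    apply: leq_trans (leq_card_setU _ _) (leq_add _ _);
      apply: card_le1 => x /eqP; [exact: h0 | exact: h1].
  by apply/setP => x; rewrite !inE.
have D2 (f : R -> R * R) c : (forall x, f x = (0, 0) -> x = c) ->
    (#|[set x | f x \in [set (0%R, 0%R)]]| <= (f c == (0%R, 0%R)))%N.
  move=> h0; rewrite (_ : [set x | _] = [set x | f x == (0, 0)]).
    by apply: card_le1 => x /eqP; apply: h0.
  by apply/setP => x; rewrite !inE.
(* The points are (1:0:0), (1:1:1), (0:1:0) and (0:0:1). *)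
apply: (@arc_of_charts _ _ chainN [set (0, 0); (1, 1)] [set (0, 0)] [set (0, 0)]).
- by move=> p /set1P->; apply: rad0.
- by move=> p /set1P->; split; apply: rad0.
- move=> a b.
  apply: leq_trans (leq_add (D1 (fun y => (y, a + b * y)) 0 1 _ _)
    (D2 (fun x => (x, a * x + b)) 0 _)) _; try by move=> x [].
  rewrite !xpair_eqE !eqxx !mulr0 mulr1 addr0 add0r /=.
  case: eqP => [->|_]; last by do 2 case: eqP.
  by rewrite add0r; case: eqP => [->|_]; rewrite ?(negPf one0) //; case: eqP.
- move=> a b bN.
  apply: leq_trans (leq_add (D1 (fun z => (a + b * z, z)) 0 1 _ _)
    (D2 (fun x => (x, a * x + b)) 0 _)) _; try by move=> x [].
  rewrite !xpair_eqE !eqxx !mulr0 mulr1 addr0 add0r !andbT /=.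
  case: eqP => [->|_]; last by do 2 case: eqP.
  by rewrite add0r; case: eqP => [E|_]; [move: N1; rewrite -E bN | case: eqP].
- move=> a b aN bN.
  apply: leq_trans (leq_add (D2 (fun z => (a + b * z, z)) 0 _)
    (D2 (fun y => (a * y + b, y)) 0 _)) _; try by move=> x [].
  by do 2 case: eqP.
by rewrite !cards1 cards2 xpair_eqE eq_sym (negPf one0).
Qed.

Lemma arc_exists (R : finNzRingType) (N : {set R}) n : chain_ring2 N ->
  (#|N| ^ 2 - #|N| <= n <= #|N| ^ 2 - 2)%N ->
  exists S : {set {set vec R}}, proj_arc S (#|N| ^ 2 * n - 2 * #|N|) n.
Proof.
move=> chainN nq.
have [th thN th0] := rad_witness chainN.
pose W := N :\ 0 :\ th.
have cW : (#|W| + 2 = #|N|)%N.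
  rewrite (cardsD1 0 N) (rad0 chainN) (cardsD1 th (N :\ 0)) !inE thN th0 /= -/W.
  by rewrite add1n add1n addn2.
have [W0|/set0Pn[g]] := eqVneq W set0.
  (* Here q = 2, which forces [n = 2] and the size 4. *)
  move: nq; rewrite -cW W0 cards0 => nq; have -> : n = 2%N by lia.
  exact: quadrangle_arc chainN.
rewrite !inE => /and3P[gth g0 gN].
(* [Y] is to have s - 2 elements; this is possible because s is at most q. *)
have yW : (#|N| ^ 2 - n - 2 <= #|W|)%N.
  by move: cW nq; move: #|W| #|N| => w m; rewrite -mulnn; lia.
have [Y /subsetP YW cY] := subset_of_card yW.
apply: (large_arc (th := th) (g := g) (Y := Y) chainN) => //.
- by apply/subsetP => x /YW; rewrite !inE => /and3P[].
- by apply/negP => /YW; rewrite !inE eqxx andbF.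
- by apply/negP => /YW; rewrite !inE eqxx.
- rewrite cY; move: cW nq; move: #|W| #|N| => w m; rewrite -mulnn => cW nq.
  have : (2 * m <= m * m)%N by rewrite leq_mul2r -cW addnC orbT.
  lia.
move: cW nq; move: #|W| #|N| => w m; rewrite -mulnn => cW nq.
have m2 : (2 * m <= m * m)%N by rewrite leq_mul2r -cW addnC orbT.
by rewrite subnK // (leq_trans m2) // leq_pmulr //; lia.
Qed.

(** For q at least 2 no subtraction truncates and both sides are equal; smaller q is treated
    directly. *)
Lemma bound_eq q n t : (q ^ 2 - q <= n <= q ^ 2 - 2)%N -> n = (q ^ 2 - q + t)%N ->
  (q * (q + 1) * n - q ^ 3 + q * (q - 2 - t) <= q ^ 2 * n - 2 * q)%N.
Proof.
move=> nq nt; have [q1|q2] := leqP q 1.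
  by move: nt nq; case: q q1 => [|[]] //=; lia.
have qq := leq_mul q2 (leqnn q).
have tq : (t + 2 <= q)%N by move: nt nq qq; rewrite -mulnn; lia.
have n0 : (0 < n)%N by move: nq qq; rewrite -mulnn; lia.
pose u := (q - 2 - t)%N; rewrite -/u; have uE : q = (u + t + 2)%N by rewrite /u; lia.
have e2 : (n + q = q ^ 2 + t)%N by move: nt qq; rewrite -mulnn; lia.
have e3 : (q * n + q ^ 2 = q ^ 3 + q * t)%N by rewrite expnS -!mulnDr -e2 mulnDr.
have e4 : (q * q = q * u + q * t + q * 2)%N by rewrite -!mulnDr -uE.
have e5 : (q * q <= q * q * n)%N by rewrite leq_pmulr.
by rewrite mulnDr muln1 mulnDl -!mulnn in e3 *; lia.
Qed.

Theorem theorem3p2 (R : finNzRingType) (N : {set R}) (q n : nat) :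
  chain_ring2 N ->
  (q * #|N| = #|R|)%N ->
  (q ^ 2 - q <= n <= q ^ 2 - 2)%N ->
  (exists S : {set {set vec R}}, proj_arc S (q ^ 2 * n - 2 * q) n) /\
  (forall t : nat, n = (q ^ 2 - q + t)%N ->
     (q * (q + 1) * n - q ^ 3 + q * (q - 2 - t) <= max_proj_arc R n)%N).
Proof.
move=> chainN qN nq.
have N0 : (0 < #|N|)%N by apply/card_gt0P; exists 0; apply: rad0.
have qE : q = #|N|.
  by apply/eqP; rewrite -(eqn_pmul2r N0) qN (card_ring chainN).
have [S arcS] : exists S : {set {set vec R}}, proj_arc S (q ^ 2 * n - 2 * q) n.
  by move: nq; rewrite qE => nq; apply: arc_exists.
split; first by exists S.
move=> t nt; have /and3P[_ /eqP cS _] := arcS.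
apply: (@leq_trans #|S|).
  by rewrite cS; apply: bound_eq.
by rewrite /max_proj_arc (bigD1 S) ?leq_maxl // cS.
Qed.
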